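(* Let $T$ be a complex torus, $T[2]$ its $2$-torsion subgroup, and $\varphi:H^*(BT,\mathbb{Z})\to H^*(BT[2],\mathbb{Z}/2\mathbb{Z})$ the ring homomorphism determined by $\varphi(c_1(\chi))=w_1(\chi|_{T[2]})$ for all $\chi\in X^*(T)$. If $\pi$ is an orthogonal representation of $T$, then $$w^{T[2]}(\pi)=\varphi(c(\pi)).$$
   Context: A complex torus is an algebraic group isomorphic to $(\mathbb{C}^\times)^r$; $X^*(T)$ is its group of algebraic characters. Representations are finite-dimensional, complex and algebraic; $\pi$ is orthogonal if its space carries an invariant nondegenerate symmetric bilinear form. $c(\pi)\in H^*(BT,\mathbb{Z})$ is the total Chern class. The first Chern class gives an isomorphism $X^*(T)\cong H^2(BT,\mathbb{Z})$ extending to a ring isomorphism $\mathrm{Sym}_{\mathbb{Z}}X^*(T)\cong H^*(BT,\mathbb{Z})$, and the first Stiefel-Whitney class gives an isomorphism $\mathrm{Hom}(T[2],\{\pm1\})\cong H^1(BT[2],\mathbb{Z}/2\mathbb{Z})$ extending to a ring isomorphism $\mathrm{Sym}(\mathrm{Hom}(T[2],\{\pm1\}))\cong H^*(BT[2],\mathbb{Z}/2\mathbb{Z})$ (symmetric algebra over $\mathbb{Z}/2\mathbb{Z}$). Via these, $\varphi$ is the surjective ring homomorphism induced by the restriction $X^*(T)\to\mathrm{Hom}(T[2],\{\pm1\})$ (it sends $H^{2k}$ to $H^k$). Stiefel-Whitney classes of a complex orthogonal representation $\pi:G\to O_n(\mathbb{C})$ of a Lie group $G$: the inclusion of the compact group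 $O_n\subset O_n(\mathbb{C})$ is a homotopy equivalence, so $H^*(BO_n(\mathbb{C}),\mathbb{Z}/2\mathbb{Z})\cong H^*(BO_n,\mathbb{Z}/2\mathbb{Z})$ is polynomial on the universal classes $w_1,\dots,w_n$; put $w_k(\pi)=\pi^*(w_k)\in H^k(BG,\mathbb{Z}/2\mathbb{Z})$ and $w(\pi)=1+w_1(\pi)+\cdots+w_n(\pi)$. $w^{T[2]}(\pi)$ is the restriction of $w(\pi)$ to $H^*(BT[2],\mathbb{Z}/2\mathbb{Z})$, i.e. the total Stiefel-Whitney class of $\pi|_{T[2]}$. *)

(* Defs.v *)
From HB Require Import structures.
From mathcomp Require Import all_boot all_order all_algebra.
From mathcomp Require Import generic_quotient ring_quotient complex.
From mathcomp Require Import all_classical all_reals all_analysis.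

Set Implicit Arguments.
Unset Strict Implicit.
Unset Printing Implicit Defensive.

Import Order.TTheory GRing.Theory Num.Theory.
Import numFieldTopology.Exports.

Local Open Scope classical_set_scope.
Local Open Scope ring_scope.
Local Open Scope complex_scope.
Local Open Scope quotient_scope.

(* The simplicial sets below carry operators for all maps [m] -> [n], not only
   for the nondecreasing ones; the cochain complex uses only the latter. *)
Record sset := SSet {
  splx :> nat -> Type;
  sact : forall m n, ('I_m.+1 -> 'I_n.+1) -> splx n -> splx m;
  sact_id : forall n (x : splx n), sact id x = x;
  sact_comp : forall k m n (h : 'I_k.+1 -> 'I_m.+1) (g : 'I_m.+1 -> 'I_n.+1)
    (x : splx n), sact h (sact g x) = sact (g \o h) x }.

Definition face (X : sset) n (i : 'I_n.+2) : X n.+1 -> X n := sact (lift i).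

Definition front (X : sset) n p : X n -> X p :=
  sact (fun i : 'I_p.+1 => inord i).

(* the face spanned by the vertices p, p + 1, ..., p + q (for p + q <= n) *)
Definition back (X : sset) n p q : X n -> X q :=
  sact (fun j : 'I_q.+1 => inord (p + j)).

Definition cochain (X : sset) (A : nzRingType) := forall n, X n -> A.

Section Cochain.
Variables (X : sset) (A : nzRingType).
Local Notation cochain := (cochain X A).
Implicit Types (a b c : cochain).

HB.instance Definition _ := gen_eqMixin cochain.
HB.instance Definition _ := gen_choiceMixin cochain.

Lemma cochainP a b : (forall n x, a n x = b n x) -> a = b.
Proof.
by move=> ab; apply: functional_extensionality_dep => n; apply/funext => x.
Qed.

Definition czero : cochain := fun _ _ => 0.
Definition copp a : cochain := fun n x => - a n x.
Definition cadd a b : cochain := fun n x => a n x + b n x.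

Fact caddA : associative cadd.
Proof. by move=> a b c; apply: cochainP => n x; rewrite /cadd addrA. Qed.
Fact caddC : commutative cadd.
Proof. by move=> a b; apply: cochainP => n x; rewrite /cadd addrC. Qed.
Fact cadd0 : left_id czero cadd.
Proof. by move=> a; apply: cochainP => n x; rewrite /cadd add0r. Qed.
Fact caddN : left_inverse czero copp cadd.
Proof. by move=> a; apply: cochainP => n x; rewrite /cadd addNr. Qed.

HB.instance Definition _ :=
  GRing.isZmodule.Build cochain caddA caddC cadd0 caddN.

Definition cone : cochain := fun n _ => (n == 0%N)%:R.

Definition cup a b : cochain := fun n x =>
  \sum_(p < n.+1) a p (front p x) * b (n - p)%N (back p (n - p) x).

Definition cobound a : cochain := fun n =>
  if n is m.+1 then fun x => \sum_(i < m.+2) (-1) ^+ i * a m (face i x)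
  else fun=> 0.

Let ev a (m : nat) (g : nat -> nat) n (x : X n) : A :=
  a m (sact (fun i : 'I_m.+1 => inord (g i)) x).

Let ev_eq a m (g g' : nat -> nat) n (x : X n) :
  (forall i, (i <= m)%N -> g i = g' i) -> ev a m g x = ev a m g' x.
Proof.
move=> gg'; congr (a m (sact _ x)); apply/funext => i.
by rewrite gg' // -ltnS.
Qed.

Let ev_id a n (x : X n) : a n x = ev a n id x.
Proof.
rewrite -{1}[x]sact_id; congr (a n (sact _ x)); apply/funext => i.
by rewrite inord_val.
Qed.

Let ev_comp a m (g : nat -> nat) k (h : nat -> nat) n (x : X n) :
  (forall i, (i <= m)%N -> (g i <= k)%N) ->
  ev a m g (sact (fun i : 'I_k.+1 => inord (h i)) x) = ev a m (h \o g) x.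
Proof.
move=> gk; rewrite /ev sact_comp; congr (a m (sact _ x)); apply/funext => i /=.
by rewrite inordK // ltnS gk // -ltnS.
Qed.

Let cupE a b m (g : nat -> nat) n (x : X n) : ev (cup a b) m g x =
  \sum_(p < m.+1) ev a p g x * ev b (m - p) (fun j => g (p + j)%N) x.
Proof.
apply: eq_bigr => p _; congr (_ * _).
  by apply: ev_comp => i ip; rewrite (leq_trans ip) // -ltnS.
have pm : (p <= m)%N by rewrite -ltnS.
by apply: ev_comp => i ip; rewrite -[leqRHS](subnKC pm) leq_add2l.
Qed.

Let coboundE a m (g : nat -> nat) n (x : X n) : ev (cobound a) m.+1 g x =
  \sum_(i < m.+2) (-1) ^+ i * ev a m (g \o bump i) x.
Proof.
apply: eq_bigr => i _; congr (_ * _).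
rewrite -(@ev_comp _ _ _ m.+1); last first.
  by move=> j jm; apply: (leq_add (leq_b1 _) jm).
rewrite /ev /face; congr (a m (sact _ _)); apply/funext => j.
by apply: val_inj; rewrite /= inordK //; apply: (ltn_ord (lift i j)).
Qed.

Let triangular_sum (F : nat -> nat -> A) n :
  \sum_(p < n.+1) \sum_(q < (n - p).+1) F p q =
  \sum_(k < n.+1) \sum_(p < k.+1) F p (k - p)%N.
Proof.
elim: n => [|n IH]; first by rewrite !big_ord1 /= ?big_ord1.
rewrite [RHS]big_ord_recr -IH /= [X in _ = _ + X]big_ord_recr /= addrA -big_split /=.
rewrite big_ord_recr /= subnn big_ord1; congr (_ + _).
by apply: eq_bigr => p _; rewrite subSn ?leq_ord // big_ord_recr.
Qed.

Fact cupA : associative cup.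
Proof.
move=> a b c; apply: cochainP => n x; rewrite [LHS]ev_id [RHS]ev_id !cupE.
pose F p q := ev a p id x * ev b q (addn p) x
  * ev c (n - (p + q)) (addn (p + q)) x.
transitivity (\sum_(p < n.+1) \sum_(q < (n - p).+1) F p q).
  apply: eq_bigr => p _; rewrite cupE big_distrr /=; apply: eq_bigr => q _.
  rewrite mulrA /F subnDA; congr (_ * _); apply: ev_eq => i _ /=.
  by rewrite addnA.
rewrite triangular_sum; apply: eq_bigr => k _.
rewrite cupE big_distrl /=; apply: eq_bigr => p _.
by rewrite /F subnKC // -ltnS.
Qed.

Fact cup1l : left_id cone cup.
Proof.
move=> a; apply: cochainP => n x.
rewrite [LHS]ev_id [RHS]ev_id cupE big_ord_recl big1 => [|i _].
  by rewrite addr0 subn0 (_ : ev cone _ _ x = 1) ?mul1r.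
by rewrite (_ : ev cone _ _ x = 0) ?mul0r.
Qed.

Fact cup1r : right_id cone cup.
Proof.
move=> a; apply: cochainP => n x.
rewrite [LHS]ev_id [RHS]ev_id cupE big_ord_recr big1 => [|i _] /=.
  by rewrite add0r subnn (_ : ev cone _ _ x = 1) ?mulr1.
rewrite (_ : ev cone _ _ x = 0) ?mulr0 //.
by rewrite /ev /cone subn_eq0 leqNgt ltn_ord.
Qed.

Lemma cochainDE a b n x : (a + b) n x = a n x + b n x. Proof. by []. Qed.
Lemma cochainNE a n x : (- a) n x = - a n x. Proof. by []. Qed.

Fact cupDl : left_distributive cup +%R.
Proof.
move=> a b c; apply: cochainP => n x; rewrite cochainDE -big_split.
by apply: eq_bigr => p _; rewrite cochainDE mulrDl.
Qed.

Fact cupDr : right_distributive cup +%R.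
Proof.
move=> a b c; apply: cochainP => n x; rewrite cochainDE -big_split.
by apply: eq_bigr => p _; rewrite cochainDE mulrDr.
Qed.

HB.instance Definition _ :=
  GRing.Zmodule_isPzRing.Build cochain cupA cup1l cup1r cupDl cupDr.

Lemma cochainME a b : a * b = cup a b. Proof. by []. Qed.

Fact cobound_is_additive : zmod_morphism cobound.
Proof.
move=> a b; apply: cochainP => n x; rewrite cochainDE cochainNE.
case: n x => [|n] x; first by rewrite subr0.
rewrite -sumrB; apply: eq_bigr => i _.
by rewrite cochainDE cochainNE mulrBr.
Qed.

HB.instance Definition _ :=
  GRing.isZmodMorphism.Build cochain cochain cobound cobound_is_additive.

Definition calt a : cochain := fun n x => (-1) ^+ n * a n x.

Let coboundE' a m (g : nat -> nat) n (x : X n) : ev (cobound a) m.+1 g x =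
  \sum_(0 <= i < m.+2) (-1) ^+ i * ev a m (g \o bump i) x.
Proof. by rewrite coboundE big_mkord. Qed.

Lemma cobound_cup a b :
  cobound (a * b) = cobound a * b + calt a * cobound b.
Proof.
apply: cochainP => n x; rewrite cochainDE !cochainME.
rewrite [LHS]ev_id [X in _ = X + _]ev_id [X in _ = _ + X]ev_id !cupE.
case: n x => [|n] x.
  by rewrite !big_ord1 [ev (cobound a) _ _ _]/= mul0r add0r /ev /= mulr0.
rewrite coboundE'.
rewrite [X in _ = X + _]big_ord_recl [X in _ = X + _ + _]mul0r add0r.
rewrite [X in _ = _ + X]big_ord_recr /= subnn [X in _ = _ + (_ + X)]mulr0 addr0.
rewrite -big_split /=.
under eq_bigr => i _ do rewrite cupE big_distrr /=.
rewrite exchange_big /=; apply: eq_bigr => p _.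
have pn : (p <= n)%N by rewrite -ltnS.
rewrite (@big_cat_nat _ _ _ p.+1) //=; last by rewrite ltnS ltnW.
rewrite /bump leq0n add1n subSS subSn // !coboundE'.
rewrite [X in _ = X * _ + _]big_nat_recr //= mulrDl mulr_suml -addrA.
rewrite [X in _ = _ + (_ + _ * X)]big_nat_recl //=.
congr (_ + _).
  apply: eq_big_nat => i /andP[_ ip]; rewrite mulrA; congr (_ * _).
  by apply: ev_eq => j _ /=; rewrite (leq_trans (ip : (i <= p)%N)) ?leq_addr.
rewrite (_ : ev a p (id \o bump p.+1) x = ev a p id x); last first.
  by apply: ev_eq => j jp; rewrite /= /bump leqNgt ltnS jp.
rewrite (_ : ev b (n - p) ([eta addn p] \o bump 0) x =
             ev b (n - p) [eta addn p.+1] x); last first.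
  by apply: ev_eq => j _; rewrite /= /bump leq0n add1n addnS.
rewrite (_ : ev (calt a) p id x = (-1) ^+ p * ev a p id x) //.
rewrite expr0 mul1r mulrDr addrA -mulrDl exprS mulN1r !mulNr addNr mul0r add0r.
rewrite -{1}[p.+1]add0n big_addn subSS subSn // mulr_sumr.
apply: eq_big_nat => i _; rewrite !mulrA.
rewrite (_ : ev a p _ x = ev a p id x); last first.
  apply: ev_eq => j jp; rewrite /= leqNgt (leq_ltn_trans jp) //.
  exact: leq_addl.
rewrite (_ : ev b _ _ x = ev b (n - p) ([eta addn p] \o bump i.+1) x); last first.
  apply: ev_eq => j jp; rewrite /= /bump addnS -addSn (addnC i.+1) leq_add2l.
  by rewrite addnCA.
congr (_ * _).
rewrite -[RHS]mulrA (commr_sign (ev a p id x)) mulrA -exprD.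
by rewrite (addnC i) addSnnS.
Qed.


Lemma cobound_calt a : cobound (calt a) = - calt (cobound a).
Proof.
apply: cochainP => n x; rewrite cochainNE; case: n x => [|n] x.
  by rewrite /calt /= mulr0 oppr0.
rewrite {2}/calt exprS mulN1r mulNr opprK /= mulr_sumr.
by apply: eq_bigr => i _; rewrite /calt !mulrA -!exprD addnC.
Qed.

Lemma caltK : involutive calt.
Proof.
by move=> a; apply: cochainP => n x; rewrite /calt mulrA -expr2 sqrr_sign mul1r.
Qed.

(* Restricting to families with finitely many nonzero components makes the
   cohomology below the direct sum (and not the product) of the H^n. *)
Definition cocycle_pred : {pred cochain} := fun a =>
  `[< (exists N, forall n (x : X n), (N <= n)%N -> a n x = 0)
      /\ cobound a = 0 >].

Fact cocycle_subring : subring_closed cocycle_pred.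
Proof.
split.
- apply/asboolP; split; first by exists 1%N => -[].
  apply: cochainP => -[//|[|n]] x.
    by rewrite /= !big_ord_recl big_ord0 /= expr0 expr1 mul1r mulr1 addr0 subrr.
  by rewrite /= big1 // => i _; rewrite mulr0.
- move=> a b /asboolP[[N aN] da] /asboolP[[M bM] db]; apply/asboolP; split.
    exists (maxn N M) => n x; rewrite geq_max => /andP[Nn Mn].
    by rewrite cochainDE cochainNE aN // bM // subrr.
  by rewrite raddfB /= da db subrr.
- move=> a b /asboolP[[N aN] da] /asboolP[[M bM] db]; apply/asboolP; split.
    exists (N + M)%N => n x NMn; rewrite cochainME; apply: big1 => p _.
    have [Np|pN] := leqP N p; first by rewrite aN // mul0r.
    have pn : (p <= n)%N by rewrite -ltnS.
    rewrite bM ?mulr0 // -(leq_add2l p) subnKC //.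
    by rewrite (leq_trans _ NMn) // leq_add2r ltnW.
  by rewrite cobound_cup da db mul0r mulr0 addr0.
Qed.

HB.instance Definition _ :=
  GRing.isSubringClosed.Build cochain cocycle_pred cocycle_subring.

Record cocycle := Cocycle {
  cocycle_val :> cochain; _ : cocycle_val \in cocycle_pred }.

HB.instance Definition _ := [isSub for cocycle_val].
HB.instance Definition _ := [Choice of cocycle by <:].
HB.instance Definition _ := [SubChoice_isSubZmodule of cocycle by <:].
HB.instance Definition _ :=
  GRing.SubZmodule_isSubPzRing.Build cochain cocycle_pred cocycle cocycle_subring.

Lemma cocycleP (z : cocycle) : cobound z = 0.
Proof. by case: z => a az /=; have /asboolP[] := az. Qed.

Definition coboundary : {pred cocycle} := fun z =>
  `[< exists b, cocycle_val z = cobound b >].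

Fact coboundary_zmod : zmod_closed coboundary.
Proof.
split; first by apply/asboolP; exists 0; rewrite raddf0.
move=> y z /asboolP[b yb] /asboolP[c zc]; apply/asboolP; exists (b - c).
by rewrite raddfB /= -yb -zc.
Qed.

HB.instance Definition _ :=
  GRing.isZmodClosed.Build cocycle coboundary coboundary_zmod.

Lemma coboundaryMl (y z : cocycle) : z \in coboundary -> y * z \in coboundary.
Proof.
move=> /asboolP[b zb]; apply/asboolP; exists (calt y * b).
rewrite cobound_cup cobound_calt cocycleP caltK /= zb.
rewrite (_ : calt 0 = 0) ?oppr0 ?mul0r ?add0r //.
by apply: cochainP => n x; apply: mulr0.
Qed.

Lemma coboundaryMr (y z : cocycle) : y \in coboundary -> y * z \in coboundary.
Proof.
move=> /asboolP[b yb]; apply/asboolP; exists (b * cocycle_val z).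
by rewrite cobound_cup cocycleP mulr0 addr0 /= yb.
Qed.

Let H := Quotient.quot coboundary.

Definition hone : H := lift_cst H 1.
Definition hmul := lift_op2 H *%R.

Fact pi_hmul : {morph \pi : x y / x * y >-> hmul x y}.
Proof.
move=> x y; unlock hmul; apply/eqP; rewrite piE Quotient.equivE.
rewrite -[_ * _](addrNK (x * repr (\pi_H y))) -mulrBr.
rewrite -addrA -mulrBl rpredD //.
  by rewrite coboundaryMl // Quotient.idealrDE opprK reprK.
by rewrite coboundaryMr // Quotient.idealrDE opprK reprK.
Qed.
Canonical pi_hone_morph := PiConst hone.
Canonical pi_hmul_morph := PiMorph2 pi_hmul.

Fact hmulA : associative hmul.
Proof. by move=> x y z; rewrite -(@reprK _ H x) -(@reprK _ H y) -(@reprK _ H z) !piE mulrA. Qed.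
Fact hmul1l : left_id hone hmul.
Proof. by move=> x; rewrite -(@reprK _ H x) !piE mul1r. Qed.
Fact hmul1r : right_id hone hmul.
Proof. by move=> x; rewrite -(@reprK _ H x) !piE mulr1. Qed.
Fact hmulDl : left_distributive hmul (@GRing.add H).
Proof.
elim/(@quotW _ H) => x; elim/(@quotW _ H) => y; elim/(@quotW _ H) => z.
by rewrite -[LHS]/(hmul (Quotient.add (\pi x) (\pi y)) (\pi z)) -Quotient.pi_add -!pi_hmul mulrDl Quotient.pi_add.
Qed.
Fact hmulDr : right_distributive hmul (@GRing.add H).
Proof.
elim/(@quotW _ H) => x; elim/(@quotW _ H) => y; elim/(@quotW _ H) => z.
by rewrite -[LHS]/(hmul (\pi x) (Quotient.add (\pi y) (\pi z))) -Quotient.pi_add -!pi_hmul mulrDr Quotient.pi_add.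
Qed.

Definition cohomology : Type := H.

HB.instance Definition _ := GRing.Zmodule.on cohomology.
HB.instance Definition _ := EqQuotient.on cohomology.
HB.instance Definition _ :=
  GRing.Zmodule_isPzRing.Build cohomology hmulA hmul1l hmul1r hmulDl hmulDr.

Definition hclass (z : cocycle) : cohomology := \pi_H z.

Lemma hclass_eq (y z : cocycle) :
  hclass y = hclass z <-> exists b, cocycle_val y - cocycle_val z = cobound b.
Proof.
have yzE : (y - z \in coboundary) = (hclass y == hclass z).
  exact: (Quotient.idealrBE coboundary).
split=> [/eqP|yz]; first by rewrite -yzE => /asboolP.
by apply/eqP; rewrite -yzE; apply/asboolP.
Qed.

Definition in_degree k (x : cohomology) : Prop :=
  exists2 z : cocycle, x = hclass z &
    forall n (s : X n), n != k -> @cocycle_val z n s = 0.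

End Cochain.

Record smap (X Y : sset) := SMap {
  smap_fun :> forall n, X n -> Y n;
  smap_act : forall m n (g : 'I_m.+1 -> 'I_n.+1) (x : X n),
    smap_fun (sact g x) = sact g (smap_fun x) }.

Section Pullback.
Variables (X Y : sset) (f : smap X Y) (A : nzRingType).

Definition cpull (a : cochain Y A) : cochain X A := fun n x => a n (f n x).

Lemma cobound_cpull a : cobound (cpull a) = cpull (cobound a).
Proof.
apply: cochainP => -[//|n] x; apply: eq_bigr => i _.
by rewrite /cpull /face smap_act.
Qed.

Fact cpull_cocycle (z : cocycle Y A) :
  cpull (cocycle_val z) \in @cocycle_pred X A.
Proof.
case: z => a az /=; have /asboolP[[N aN] da] := az.
apply/asboolP; split; first by exists N => n x /aN; apply.
by rewrite cobound_cpull da.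
Qed.

Definition zpull (z : cocycle Y A) : cocycle X A := Cocycle (cpull_cocycle z).

Definition pullback (x : cohomology Y A) : cohomology X A :=
  hclass (zpull (repr x)).

Lemma pullback_class z : pullback (hclass z) = hclass (zpull z).
Proof.
apply/hclass_eq; have /hclass_eq[b zb] : hclass (repr (hclass z)) = hclass z.
  exact: reprK.
exists (cpull b); rewrite cobound_cpull -zb.
by apply: cochainP => n x.
Qed.

End Pullback.

Section Simplex.
Variable R : realType.

Definition stdsimplex n : set 'rV[R]_n.+1 :=
  [set t | (forall i, 0 <= t 0 i) /\ \sum_i t 0 i = 1].

Arguments stdsimplex : clear implicits.

Section Push.
Variables (m n : nat) (g : 'I_m.+1 -> 'I_n.+1).

Definition simplex_push_row (t : 'rV[R]_m.+1) : 'rV[R]_n.+1 :=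
  \row_k \sum_(i | g i == k) t 0 i.

Fact simplex_push_subproof (t : stdsimplex m) :
  simplex_push_row (set_val t) \in stdsimplex n.
Proof.
have [t0 t1] := set_valP t; apply/mem_set; split=> [k|].
  by rewrite mxE sumr_ge0.
rewrite -[RHS]t1 [RHS](partition_big g xpredT) //=.
by apply: eq_bigr => k _; rewrite mxE.
Qed.

(* the affine map sending the vertex i to the vertex (g i) *)
Definition simplex_push (t : stdsimplex m) : stdsimplex n :=
  SigSub (simplex_push_subproof t).

Lemma simplex_push_continuous : continuous simplex_push.
Proof.
have ck k : continuous (fun s : stdsimplex m =>
    simplex_push_row (set_val s) 0 k).
  have -> : (fun s : stdsimplex m => simplex_push_row (set_val s) 0 k) =
      (fun s => \sum_(i | g i == k) set_val s 0 i).
    by apply/funext => s; rewrite mxE.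
  apply: continuous_big => [|i _ s]; first exact: add_continuous.
  apply: (@continuous_comp _ _ _ set_val (fun M : 'rV[R]_m.+1 => M 0 i)).
    exact: initial_continuous.
  exact: coord_continuous.
apply: (@continuous_comp_initial _ _ _ set_val) => t A [P nP PA].
have: \forall s \near t, forall k, P 0 k (simplex_push_row (set_val s) 0 k).
  apply: (@filter_forall _ _ _ _ (nbhs_filter t)) => k.
  exact: (ck k t _ (nP 0 k)).
by apply: filterS => s sP; apply: PA => i j; rewrite ord1.
Qed.

End Push.

Lemma simplex_push_id n (t : stdsimplex n) : simplex_push id t = t.
Proof.
apply/val_inj/rowP => k; rewrite mxE.
by rewrite (eq_bigl (pred1 k)) ?big_pred1_eq.
Qed.

Lemma simplex_push_comp k m n (h : 'I_k.+1 -> 'I_m.+1) (g : 'I_m.+1 -> 'I_n.+1)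
  (t : stdsimplex k) :
  simplex_push g (simplex_push h t) = simplex_push (g \o h) t.
Proof.
apply/val_inj/rowP => j; rewrite !mxE.
rewrite [RHS](partition_big h (fun i => g i == j)) //=.
apply: eq_bigr => i /eqP gij; rewrite mxE; apply: eq_bigl => l.
by case: (h l =P i) => [->|]; rewrite ?gij ?eqxx ?andbF.
Qed.

End Simplex.

Arguments stdsimplex : clear implicits.

#[export, non_forgetful_inheritance]
HB.instance Definition _ (R : rcfType) := PseudoPointedMetric.copy R[i] R[i]^o.

(* A subgroup of GL_N(C), with the subspace topology *)
Record lingroup (R : realType) N := LinGroup {
  lset :> set 'M[R[i]]_N;
  lingroup_unit : forall x, lset x -> x \in unitmx;
  lingroup1 : lset 1%:M;
  lingroupM : forall x y, lset x -> lset y -> lset (x *m y);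
  lingroupV : forall x, lset x -> lset (invmx x) }.

(* Continuous homomorphisms; the values outside G are irrelevant. *)
Record lhom (R : realType) N M (G : lingroup R N) (H : lingroup R M) := LHom {
  lhom_fun :> 'M[R[i]]_N -> 'M[R[i]]_M;
  lhom_mem : forall x, lset G x -> lset H (lhom_fun x);
  lhomM : forall x y, lset G x -> lset G y ->
    lhom_fun (x *m y) = lhom_fun x *m lhom_fun y;
  lhom_continuous : {within G, continuous lhom_fun} }.

Section Classifying.
Variable R : realType.
Local Notation C := R[i].

Section Space.
Variables (N : nat) (G : lingroup R N).

(* Sing G is a simplicial group, and B G is modelled by the diagonal of its
   nerve: an n-simplex is a functor from the ordered set [n] to the group of
   continuous maps from the standard n-simplex to G.  Its realization is weakly
   equivalent to the classifying space of the topological group G.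
   A functor on [n] extends uniquely to the codiscrete groupoid on n + 1
   objects, hence the families indexed by all pairs (i, j). *)
Record bsimplex n := BSimplex {
  bfun : 'I_n.+1 -> 'I_n.+1 -> stdsimplex R n -> 'M[C]_N;
  bsimplex_mem : forall i j t, lset G (bfun i j t);
  bsimplexM : forall i j k t, bfun i j t *m bfun j k t = bfun i k t;
  bsimplex_continuous : forall i j, continuous (bfun i j) }.

Lemma bsimplexP n (s t : bsimplex n) :
  (forall i j u, bfun s i j u = bfun t i j u) -> s = t.
Proof.
case: s t => [s s1 s2 s3] [t t1 t2 t3] /= st.
have {}st : s = t.
  by apply/funext => i; apply/funext => j; apply/funext => u; apply: st.
subst t; congr BSimplex; exact: Prop_irrelevance.
Qed.

Section Act.
Variables (m n : nat) (g : 'I_m.+1 -> 'I_n.+1) (s : bsimplex n).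
Let f i j t := bfun s (g i) (g j) (simplex_push g t).

Let f_mem i j t : lset G (f i j t). Proof. exact: bsimplex_mem. Qed.

Let fM i j k t : f i j t *m f j k t = f i k t.
Proof. exact: bsimplexM. Qed.

Let f_continuous i j : continuous (f i j).
Proof.
move=> t; apply: (@continuous_comp _ _ _ (simplex_push g)).
  exact: simplex_push_continuous.
exact: bsimplex_continuous.
Qed.

Definition bact := BSimplex f_mem fM f_continuous.
End Act.

Fact bact_id n (s : bsimplex n) : bact id s = s.
Proof. by apply: bsimplexP => i j u; rewrite /= simplex_push_id. Qed.

Fact bact_comp k m n (h : 'I_k.+1 -> 'I_m.+1) (g : 'I_m.+1 -> 'I_n.+1)
  (s : bsimplex n) : bact h (bact g s) = bact (g \o h) s.
Proof. by apply: bsimplexP => i j u; rewrite /= simplex_push_comp. Qed.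

Definition classifying : sset := SSet bact_id bact_comp.

End Space.

Section Map.
Variables (N M : nat) (G : lingroup R N) (H : lingroup R M) (f : lhom G H).

Section Simplex.
Variables (n : nat) (s : bsimplex G n).
Let g i j t := f (bfun s i j t).

Let g_mem i j t : lset H (g i j t). Proof. exact/lhom_mem/bsimplex_mem. Qed.

Let gM i j k t : g i j t *m g j k t = g i k t.
Proof. by rewrite -lhomM ?bsimplexM; [|exact: bsimplex_mem..]. Qed.

Let g_continuous i j : continuous (g i j).
Proof.
move=> t A /= nA.
have /subspace_continuousP fc := @lhom_continuous _ _ _ _ _ f.
have := fc _ (bsimplex_mem s i j t) _ nA.
rewrite /= /within /= => /(@bsimplex_continuous _ _ _ s i j t) nfA.
apply: (@filterS _ _ (nbhs_filter t) _ _ _ nfA) => u /= uA.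
by apply: uA; apply: bsimplex_mem.
Qed.

Definition bmap_fun := BSimplex g_mem gM g_continuous.
End Simplex.

Fact bmap_act m n (g : 'I_m.+1 -> 'I_n.+1) (s : bsimplex G n) :
  bmap_fun (bact g s) = bact g (bmap_fun s).
Proof. exact: bsimplexP. Qed.

Definition bmap : smap (classifying G) (classifying H) :=
  @SMap (classifying G) (classifying H) bmap_fun bmap_act.

End Map.

End Classifying.


Notation Hcoh G A := (cohomology (classifying G) A).

Definition hmap (R : realType) N M (G : lingroup R N) (H : lingroup R M)
  (f : lhom G H) (A : nzRingType) : Hcoh H A -> Hcoh G A :=
  @pullback _ _ (bmap f) A.

Section Groups.
Variable R : realType.
Local Notation C := R[i].

Section Fixed.
Variable n : nat.

Fact GL_subproof (x y : 'M[C]_n) :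
  x \in unitmx -> y \in unitmx -> x *m y \in unitmx.
Proof. by move=> ux uy; rewrite unitmx_mul ux. Qed.

Fact GLV_subproof (x : 'M[C]_n) : x \in unitmx -> invmx x \in unitmx.
Proof. by rewrite unitmx_inv. Qed.

Definition GLn : lingroup R n :=
  @LinGroup R n [set x | x \in unitmx] (fun _ => id) (unitmx1 _ _)
    GL_subproof GLV_subproof.

Let On_set : set 'M[C]_n := [set x | x *m x^T = 1%:M].

Fact On_unit x : On_set x -> x \in unitmx.
Proof. by move=> /mulmx1_unit[]. Qed.

Fact On1 : On_set 1%:M. Proof. by rewrite /On_set /= trmx1 mulmx1. Qed.

Fact OnM x y : On_set x -> On_set y -> On_set (x *m y).
Proof.
move=> xx yy; rewrite /On_set /= trmx_mul mulmxA -(mulmxA x) yy mulmx1.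
exact: xx.
Qed.

Fact OnV x : On_set x -> On_set (invmx x).
Proof.
move=> xx; have ux := On_unit xx.
have -> : invmx x = x^T by rewrite -[RHS](mulKmx ux) xx mulmx1.
by rewrite /On_set /= trmxK; apply: mulmx1C.
Qed.

Definition On : lingroup R n := LinGroup On_unit On1 OnM OnV.

Let Gm_set : set 'M[C]_n :=
  [set diag_mx d | d in [set d : 'rV[C]_n | forall i, d 0 i != 0]].

Fact Gm_unit x : Gm_set x -> x \in unitmx.
Proof.
move=> [d d0 <-]; rewrite unitmxE det_diag unitfE.
by apply/prodf_neq0 => i _; apply: d0.
Qed.

Fact Gm1 : Gm_set 1%:M.
Proof.
exists (const_mx 1) => [i|]; first by rewrite mxE oner_eq0.
exact: diag_const_mx.
Qed.

Fact GmM x y : Gm_set x -> Gm_set y -> Gm_set (x *m y).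
Proof.
move=> [d d0 <-] [e e0 <-]; exists (\row_j (d 0 j * e 0 j)).
  by move=> i; rewrite mxE mulf_neq0.
by rewrite mulmx_diag.
Qed.

Fact GmV x : Gm_set x -> Gm_set (invmx x).
Proof.
move=> Gx; have ux := Gm_unit Gx; case: Gx ux => d d0 <- ux.
exists (\row_j (d 0 j)^-1) => [i|]; first by rewrite mxE invr_eq0.
rewrite -[RHS]mulmx1 -diag_const_mx.
have -> : const_mx 1 = \row_j (d 0 j * (\row_j (d 0 j)^-1) 0 j).
  by apply/rowP => j; rewrite !mxE mulfV.
by rewrite -mulmx_diag mulKmx.
Qed.

(* The standard torus of rank n, as the group of diagonal matrices *)
Definition Gm : lingroup R n := LinGroup Gm_unit Gm1 GmM GmV.

(* The algebra of regular functions on GL_n *)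
Inductive regular : ('M[C]_n -> C) -> Prop :=
| regular_entry i j : regular (fun x => x i j)
| regular_cst c : regular (fun=> c)
| regular_detV : regular (fun x => (\det x)^-1)
| regularD p q : regular p -> regular q -> regular (fun x => p x + q x)
| regularM p q : regular p -> regular q -> regular (fun x => p x * q x).

Definition zariski_closed (G : lingroup R n) : Prop :=
  exists2 S : set ('M[C]_n -> C), S `<=` regular &
    forall x, lset G x <-> x \in unitmx /\ forall p, S p -> p x = 0.

End Fixed.

Definition algebraic N M (G : lingroup R N) (H : lingroup R M)
    (f : lhom G H) : Prop :=
  forall i j, exists2 p, regular p & forall x, lset G x -> f x i j = p x.

(* An algebraic group isomorphic to (C^x)^r for some r *)
Record torus N := Torus {
  torus_group :> lingroup R N;
  torus_closed : zariski_closed torus_group;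
  torus_iso : exists r (f : lhom torus_group (Gm r))
      (g : lhom (Gm r) torus_group),
    [/\ algebraic f, algebraic g,
      forall x, lset torus_group x -> g (f x) = x &
      forall y, lset (Gm r) y -> f (g y) = y] }.

Lemma lhom1 N M (G : lingroup R N) (H : lingroup R M) (f : lhom G H) :
  f 1%:M = 1%:M.
Proof.
have G1 := lingroup1 G; have uf := lingroup_unit (lhom_mem f G1).
have := lhomM f G1 G1; rewrite mulmx1 => /(congr1 (mulmx (invmx (f 1%:M)))).
by rewrite mulKmx // mulVmx.
Qed.

Section TwoTorsion.
Variables (N : nat) (T : torus N).

Lemma torus_comm x y : lset T x -> lset T y -> x *m y = y *m x.
Proof.
have [r [f [g [_ _ gf _]]]] := torus_iso T => Tx Ty.
rewrite -(gf _ (lingroupM Tx Ty)) -(gf _ (lingroupM Ty Tx)); congr (g _).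
rewrite !lhomM //.
have [d _ <-] := lhom_mem f Tx; have [e _ <-] := lhom_mem f Ty.
by rewrite !mulmx_diag; congr diag_mx; apply/rowP => j; rewrite !mxE mulrC.
Qed.

Let T2_set : set 'M[C]_N := [set x | lset T x /\ x *m x = 1%:M].

Fact T2_unit x : T2_set x -> x \in unitmx.
Proof. by case=> /lingroup_unit. Qed.

Fact T2_1 : T2_set 1%:M.
Proof. by split; [exact: lingroup1|rewrite mulmx1]. Qed.

Fact T2_M x y : T2_set x -> T2_set y -> T2_set (x *m y).
Proof.
move=> [Tx xx] [Ty yy]; split; first exact: lingroupM.
by rewrite -mulmxA (mulmxA y) -(torus_comm Tx Ty) -mulmxA yy mulmx1.
Qed.

Fact T2_V x : T2_set x -> T2_set (invmx x).
Proof.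
move=> T2x; have ux := T2_unit T2x; case: T2x => Tx xx.
suff -> : invmx x = x by split.
by rewrite -[RHS](mulKmx ux) xx mulmx1.
Qed.

Definition two_torsion : lingroup R N := LinGroup T2_unit T2_1 T2_M T2_V.

Fact incl2_subproof : {within two_torsion, continuous (@id 'M[C]_N)}.
Proof. by apply: continuous_subspaceT => x; apply: cvg_id. Qed.

Definition incl2 : lhom two_torsion T :=
  @LHom R N N two_torsion T id (fun x => @proj1 _ _) (fun _ _ _ _ => erefl)
    incl2_subproof.

Section Character.
Variable chi : lhom T (GLn 1).

Fact char2_mem x : lset two_torsion x -> lset (On 1) (chi x).
Proof.
move=> [Tx xx]; rewrite /= /mkset.
have -> : (chi x)^T = chi x by apply/matrixP => i j; rewrite mxE !ord1.
by rewrite -lhomM // xx lhom1.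
Qed.

Fact char2_mul x y : lset two_torsion x -> lset two_torsion y ->
  chi (x *m y) = chi x *m chi y.
Proof. by move=> [Tx _] [Ty _]; apply: lhomM. Qed.

Fact char2_continuous : {within two_torsion, continuous chi}.
Proof.
by apply: continuous_subspaceW (@lhom_continuous _ _ _ _ _ chi) => x [].
Qed.

(* chi restricted to T[2], with values in O_1 = {1, -1} *)
Definition char2 : lhom two_torsion (On 1) :=
  LHom char2_mem char2_mul char2_continuous.

End Character.
End TwoTorsion.

Section Universal.
Variables (F : forall n, lingroup R n) (A : nzRingType).
Variable c : forall n, nat -> Hcoh (F n) A.

Definition total_class N (G : lingroup R N) n (f : lhom G (F n)) : Hcoh G A :=
  \sum_(k < n.+1) hmap f (c n k).

(* The usual axioms.  Naturality is built in, and the Whitney formula, stated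
   for an arbitrary G, is equivalent to its universal case G = F_m x F_n. *)
Record universal_classes (d : nat) : Prop := UniversalClasses {
  universal_degree : forall n k, in_degree (d * k) (c n k);
  universal0 : forall n, c n 0%N = 1;
  universal_vanish : forall n k, (n < k)%N -> c n k = 0;
  universal_whitney : forall N (G : lingroup R N) m n (f : lhom G (F m))
    (g : lhom G (F n)) (h : lhom G (F (m + n)%N)),
    (forall x, lset G x -> h x = block_mx (f x) 0 0 (g x)) ->
    total_class h = total_class f * total_class g }.

End Universal.

(* H^2(B GL_1(C), Z) is infinite cyclic, generated by the first Chern class of
   the tautological line bundle.  Both choices of sign for the generator are
   allowed; they give families differing by (-1)^k in degree 2k.  Together with
   the axioms above this determines the classes up to that sign, because
   H^*(B GL_n) injects into H^*(B GL_1^n). *)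
Definition chern_classes (c : forall n, nat -> Hcoh (GLn n) int) : Prop :=
  universal_classes c 2 /\
  forall x, in_degree 2 x -> exists m : int, x = c 1%N 1%N *~ m.

(* H^1(B O_1, Z/2) = Z/2, so w 1 1 is its generator. *)
Definition stiefel_whitney_classes
    (w : forall n, nat -> Hcoh (On n) 'F_2) : Prop :=
  universal_classes w 1 /\ w 1%N 1%N != 0.

Section Orthogonal.
Variables (N : nat) (G : lingroup R N) (n : nat) (pi : lhom G (GLn n)).

Definition invariant_form (B : 'M[C]_n) : Prop :=
  [/\ B^T = B, B \in unitmx &
    forall x, lset G x -> (pi x)^T *m B *m pi x = B].

(* The columns of P are a B-orthonormal basis of C^n, in which pi becomes the
   homomorphism rho : G -> O_n(C). *)
Definition orthonormal_matrices (B P : 'M[C]_n) (rho : lhom G (On n)) : Prop :=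
  P^T *m B *m P = 1%:M /\ forall x, lset G x -> pi x *m P = P *m rho x.

End Orthogonal.
End Groups.

(* Main.v *)
Require Import Defs.
From mathcomp Require Import all_boot all_order all_algebra.
From mathcomp Require Import cyclic separable cyclotomic.
From mathcomp Require Import zify ring.
From mathcomp Require Import complex.
From mathcomp Require Import all_classical all_reals all_analysis.

Set Implicit Arguments.
Unset Strict Implicit.
Unset Printing Implicit Defensive.

Import Order.TTheory GRing.Theory Num.Theory.
Import numFieldTopology.Exports.
Local Open Scope ring_scope.
Local Open Scope complex_scope.

(* A representation of a torus is diagonalized by some Q, with characters chi_i,
   so c(pi) is the product of the 1 + c_1(chi_i).  On T[2] the chi_i take the
   values 1 and -1, so invariance of the form B makes the Gram matrix
   G = Q^T B Q commute with the diagonal matrices diag (chi_i x).  The matrix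
   M = G^(-1/2), taken as a polynomial in G^-1, is then symmetric and commutes
   with them too, so Q M is a B-orthonormal eigenbasis for T[2] carrying the
   same characters in the same order, and w(pi|T[2]) is the product of the
   1 + w_1(chi_i|T[2]).  Keeping the order avoids commutativity of the cup
   product.  Changes of basis do not affect the classes, because conjugation by
   an element of a group is simplicially homotopic to the identity on its
   classifying space. *)

(** * Functoriality of cohomology in the simplicial set *)

Section Pullback.
Variable A : nzRingType.

Lemma hclassP (X : sset) (x : cohomology X A) : exists z, x = hclass z.
Proof. by exists (repr x); rewrite /hclass reprK. Qed.

Lemma hclassD (X : sset) (y z : cocycle X A) :
  hclass (y + z) = hclass y + hclass z.
Proof. exact: Quotient.pi_add. Qed.

Lemma hclass1 (X : sset) : hclass (1 : cocycle X A) = 1.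
Proof. by rewrite /hclass piE. Qed.

Lemma pullbackD (X Y : sset) (f : smap X Y) (x y : cohomology Y A) :
  pullback f (x + y) = pullback f x + pullback f y.
Proof.
have [a ->] := hclassP x; have [b ->] := hclassP y.
rewrite -hclassD !pullback_class -hclassD; congr hclass.
exact/val_inj/cochainP.
Qed.

Lemma pullback1 (X Y : sset) (f : smap X Y) :
  pullback f (1 : cohomology Y A) = 1.
Proof.
rewrite -!hclass1 pullback_class; congr hclass.
exact/val_inj/cochainP.
Qed.

Lemma pullback_comp (X Y Z : sset) (f : smap X Y) (g : smap Y Z)
    (h : smap X Z) (x : cohomology Z A) :
  (forall n (s : X n), h n s = g n (f n s)) ->
  pullback f (pullback g x) = pullback h x.
Proof.
move=> hE; have [a ->] := hclassP x; rewrite !pullback_class; congr hclass.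
by apply/val_inj/cochainP => n s; rewrite /= /cpull hE.
Qed.

End Pullback.

(* The terms of the double sum off the two diagonals [j = i] and [j = i + 1]
   cancel against those of [b], the rest telescopes. *)
Lemma prism_sum (A : pzRingType) n (a b : nat -> nat -> A) (d : nat -> A) :
  (forall i, (i <= n)%N -> a i i = d i) ->
  (forall i, (i <= n)%N -> a i i.+1 = d i.+1) ->
  (forall i j, (j <= i)%N -> (i < n)%N -> a i.+1 j = b i j) ->
  (forall i j, (i < j)%N -> (j <= n)%N -> a i j.+1 = b i j) ->
  \sum_(0 <= i < n.+1) \sum_(0 <= j < n.+2) (-1) ^+ (i + j) * a i j =
  d 0%N - d n.+1
  - \sum_(0 <= i < n) \sum_(0 <= j < n.+1) (-1) ^+ (i + j) * b i j.
Proof.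
move=> ad aSd lo hi.
have split_row i : (i <= n)%N ->
    \sum_(0 <= j < n.+2) (-1) ^+ (i + j) * a i j =
    \sum_(0 <= j < i) (-1) ^+ (i + j) * a i j + (d i - d i.+1)
    - \sum_(i.+1 <= j < n.+1) (-1) ^+ (i + j) * b i j.
  move=> le_in; rewrite (big_cat_nat _ (n := i)) //=; last exact/leqW/leqW.
  rewrite [X in _ + X]big_ltn ?ltnS ?leqW // [X in _ + (_ + X)]big_ltn ?ltnS //.
  rewrite ad // aSd // addnS exprS addnn -mul2n exprM sqrrN !expr1n.
  rewrite mulr1 mulN1r mul1r !addrA; congr (_ + _).
  rewrite big_add1 -sumrN; apply: eq_big_nat => j /andP[lt_ij lt_jn].
  by rewrite hi // addnS exprS mulN1r mulNr.
under eq_big_nat => i /andP[_ lt_in] do rewrite split_row //.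
rewrite 2!big_split /=.
rewrite [X in _ + X + _](telescope_sumr_eq (fun i => - d i)) => [|//|i _];
  last first.
  by rewrite /= opprK addrC.
rewrite opprK addrAC addrC (addrC (- d n.+1)); congr (_ + _).
rewrite big_nat_recl // [X in X + _ + _]big_geq // add0r.
rewrite big_nat_recr //= [X in _ + (_ + - X)]big_geq // oppr0 addr0.
rewrite -big_split -sumrN; apply: eq_big_nat => i /= lt_in.
rewrite [in RHS](big_cat_nat _ (n := i.+1)) //=; last by rewrite ltnS ltnW.
rewrite opprD -[in RHS]sumrN; congr (_ - _); apply: eq_big_nat => j /= le_ji.
by rewrite lo // addSn exprS mulN1r mulNr.
Qed.

(** * Homotopy invariance *)

Section Homotopy.
Variables (X Y : sset) (A : nzRingType).
Variable tw : forall n, ('I_n.+1 -> bool) -> X n -> Y n.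
Hypothesis twE : forall m n (g : 'I_m.+1 -> 'I_n.+1) e (x : X n),
  sact g (tw e x) = tw (e \o g) (sact g x).

(* [tw] is a simplicial map from [X] times the codiscrete simplicial set on two
   vertices, that is, a homotopy between its two ends. *)
Lemma homotopic_cocycle (z : cocycle Y A) : exists b : cochain X A,
  forall n (x : X n), @cocycle_val _ _ z n (tw (fun=> true) x)
    - @cocycle_val _ _ z n (tw (fun=> false) x) = @cobound _ _ b n x.
Proof.
pose T m (e : nat -> bool) (g : nat -> nat) n (x : X n) : A :=
  @cocycle_val _ _ z m
    (tw (fun i : 'I_m.+1 => e i) (sact (fun i => inord (g i)) x)).
have eqT m e e' g g' n (x : X n) : (forall i, (i <= m)%N -> e i = e' i) ->
    (forall i, (i <= m)%N -> g i = g' i) -> T m e g n x = T m e' g' n x.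
  move=> ee' gg'; congr (@cocycle_val _ _ z m (tw _ (sact _ x))).
    by apply/funext => i; rewrite ee' // -ltnS.
  by apply/funext => i; rewrite gg' // -ltnS.
(* The prism operator: the [i]-th prism over [x] repeats vertex [i], with vertices up to [i] marked
   false and the later ones true. *)
pose b : cochain X A := fun n x =>
  \sum_(0 <= i < n.+1) (-1) ^+ i * T n.+1 (fun k => i < k)%N (unbump i) n x.
exists b => n x.
(* [a i j] evaluates [z] on the [j]-th face of the [i]-th prism, [b' i j] on the [i]-th prism over
   the [j]-th face of [x], and [d i] on the wall between consecutive prisms. *)
pose a i j := T n (fun k => i < bump j k)%N (unbump i \o bump j) n x.
pose b' i j := T n (fun k => i < k)%N (bump j \o unbump i) n x.
pose d i := T n (fun k => i <= k)%N id n x.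
have := @prism_sum A n a b' d.
(* Row [i] is, up to sign, the coboundary of [z] on the [i]-th prism, and [z] is a cocycle. *)
have -> : \sum_(0 <= i < n.+1) \sum_(0 <= j < n.+2) (-1) ^+ (i + j) * a i j = 0.
  apply: big1 => i _.
  have := cocycleP z => /(congr1 (fun c : cochain Y A => @c n.+1
    (tw (fun k : 'I_n.+2 => i < k)%N (sact (fun k => inord (unbump i k)) x)))).
  move=> /(congr1 (fun c => (-1) ^+ i * c)); rewrite mulr0 => zi0.
  rewrite -[RHS]zi0 /= big_mkord mulr_sumr; apply: eq_bigr => j _.
  by rewrite mulrA exprD /face twE sact_comp.
move=> prism; have {prism} := prism _ _ _ _.
have d0 : d 0%N = @cocycle_val _ _ z n (tw (fun=> true) x).
  rewrite /d /T; congr (@cocycle_val _ _ z n (tw _ _)).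
  rewrite -[RHS]sact_id; congr sact.
  by apply/funext => i; rewrite inord_val.
have dn : d n.+1 = @cocycle_val _ _ z n (tw (fun=> false) x).
  rewrite /d /T; congr (@cocycle_val _ _ z n (tw _ _)).
    by apply/funext => i; rewrite leqNgt ltn_ord.
  rewrite -[RHS]sact_id; congr sact.
  by apply/funext => i; rewrite inord_val.
rewrite d0 dn => prism; apply/eqP; rewrite -subr_eq0; apply/eqP/esym.
rewrite [LHS]prism.
- congr (_ - _); rewrite /b' {prism d0 dn a b' d}; case: n x => [|n] x.
    by rewrite big_geq.
  rewrite /= exchange_big_nat big_mkord; apply: eq_bigr => j _.
  rewrite mulr_sumr; apply: eq_big_nat => i /= lt_in.
  rewrite mulrA exprD commr_sign.
  congr (_ * _); rewrite /T /face sact_comp.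
  congr (@cocycle_val _ _ z _ (tw _ (sact _ _))).
  apply/funext => k; apply: val_inj => /=.
  have := ltn_ord k; have := ltn_ord j => lt_j lt_k.
  by rewrite !inordK // /bump /unbump; lia.
- move=> i le_in; apply: eqT => k _ /=; last exact: bumpK.
  by rewrite /bump; lia.
- move=> i le_in; apply: eqT => k _ /=; rewrite /bump /unbump; lia.
- move=> i j le_ji lt_in; apply: eqT => k _ /=; rewrite /bump /unbump; lia.
- move=> i j lt_ij le_jn; apply: eqT => k _ /=; rewrite /bump /unbump; lia.
Qed.

(** [hclass_eq] puts no finiteness condition on the bounding cochain, so the one of
    [homotopic_cocycle] serves as it is. *)
Lemma homotopic_pullback (f g : smap X Y) (x : cohomology Y A) :
  (forall n (s : X n), f n s = tw (fun=> false) s) ->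
  (forall n (s : X n), g n s = tw (fun=> true) s) ->
  pullback f x = pullback g x.
Proof.
move=> ftw gtw; have [z ->] := hclassP x; rewrite !pullback_class.
apply/esym/hclass_eq; have [b zb] := homotopic_cocycle z; exists b.
apply: cochainP => n s; rewrite -zb cochainDE cochainNE /= /cpull.
by rewrite ftw gtw.
Qed.
End Homotopy.

(** * Matrices over an algebraically closed field *)

Section ClosedField.
Variable F : numClosedFieldType.

(* Hensel lifting one root at a time: [p + c f] with a suitable constant [c]
   gains the factor ['X - a]. *)
Lemma sqrtX_modp (s : seq F) : 0 \notin s ->
  exists p : {poly F}, \prod_(a <- s) ('X - a%:P) %| p ^+ 2 - 'X.
Proof.
elim: s => [_|a s IH]; first by exists 0; rewrite big_nil dvd1p.
rewrite in_cons negb_or eq_sym => /andP[a0 /IH[p]].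
set f := \prod_(b <- s) _ => /dvdpP[g pg].
suff [c gc] : exists c : F, root (g + 2 *: (c *: p) + c ^+ 2 *: f) a.
  exists (p + c *: f); rewrite big_cons -/f.
  have -> : (p + c *: f) ^+ 2 - 'X = (g + 2 *: (c *: p) + c ^+ 2 *: f) * f.
    by rewrite sqrrD addrAC (addrAC (p ^+ 2)) pg -!mul_polyC; ring.
  by rewrite dvdp_mul // dvdp_XsubCl.
(* At [a] this is a quadratic equation in [c] with leading coefficient [f.[a]]. If that vanishes,
   the equation is linear, and solvable because [p.[a] ^+ 2 = a] is nonzero; otherwise the quadratic
   formula applies. *)
have [fa|fa] := eqVneq f.[a] 0.
  have pa : p.[a] != 0.
    apply: contraNneq a0 => pa; have /(congr1 (horner^~ a)) := pg.
    by rewrite !hornerE pa fa mulr0 expr0n sub0r => /eqP; rewrite oppr_eq0.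
  exists (- g.[a] / (2 * p.[a])); apply/rootP; rewrite !(hornerD, hornerZ) fa.
  by field.
pose d := sqrtC (p.[a] ^+ 2 - g.[a] * f.[a]).
have dE : d ^+ 2 = p.[a] ^+ 2 - g.[a] * f.[a] by rewrite sqrtCK.
exists ((d - p.[a]) / f.[a]); apply/rootP; rewrite !(hornerD, hornerZ).
have -> : g.[a] = (p.[a] ^+ 2 - d ^+ 2) / f.[a] by rewrite dE; field.
by field.
Qed.

Lemma prim_root_exists (n : nat) :
  (0 < n)%N -> exists z : F, n.-primitive_root z.
Proof.
move=> n_gt0; have [r Dp] := closed_field_poly_normal ('X^n - 1 : {poly F}).
rewrite (monicP _) ?monicXnsubC // scale1r in Dp.
have rn1 : all n.-unity_root r by apply/allP => z; rewrite -root_prod_XsubC -Dp.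
have sz_r : (n < (size r).+1)%N.
  by rewrite -(size_prod_XsubC r id) -Dp size_XnsubC.
have [|z] := hasP (has_prim_root n_gt0 rn1 _ sz_r); last by exists z.
by rewrite -separable_prod_XsubC -Dp separable_Xn_sub_1 // pnatr_eq0 -lt0n.
Qed.

(** The minimal polynomial divides ['X^k - 1], which splits with distinct roots in characteristic 0.
    The power is an iterated product so as to include size 0. *)
Lemma diagonalizable_finite_order n (A : 'M[F]_n) k : (0 < k)%N ->
  iter k (mulmx A) 1%:M = 1%:M -> diagonalizable A.
Proof.
case: n A => [|n] A k_gt0 Ak; first by rewrite thinmx0; exact: diagonalizable0.
apply/diagonalizableP.
have [r Dp] := closed_field_poly_normal ('X^k - 1 : {poly F}).
rewrite (monicP _) ?monicXnsubC // scale1r in Dp.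
exists r.
  by rewrite -separable_prod_XsubC -Dp separable_Xn_sub_1 // pnatr_eq0 -lt0n.
rewrite -Dp; apply: mxminpoly_min.
rewrite rmorphB rmorphXn rmorph1 /= horner_mx_X.
suff -> : A ^+ k = 1 by rewrite subrr.
rewrite -[RHS]Ak; elim: k {Ak k_gt0 Dp} => [|k IH] //=.
by rewrite exprS IH.
Qed.

(** Since 0 is not an eigenvalue, [sqrtX_modp] makes ['X] a square modulo the characteristic
    polynomial, which kills [A] by Cayley-Hamilton. *)
Lemma mx_sqrt n (A : 'M[F]_n.+1) : A \in unitmx ->
  exists p, horner_mx A p ^+ 2 = A.
Proof.
move=> uA; have [s sE] := closed_field_poly_normal (char_poly A).
rewrite (monicP (char_poly_monic A)) scale1r in sE.
have s0 : 0 \notin s.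
  rewrite -root_prod_XsubC -sE -eigenvalue_root_char.
  apply/negP => /eigenvalueP[v]; rewrite scale0r.
  move=> /(congr1 (mulmx^~ (invmx A))).
  by rewrite mulmxK // mul0mx => -> /eqP.
have [p] := sqrtX_modp s0; rewrite -sE => /dvdpP[q pq]; exists p.
have /(congr1 (horner_mx A)) := pq; rewrite rmorphM /= Cayley_Hamilton mulr0.
by rewrite rmorphB rmorphXn /= horner_mx_X => /eqP; rewrite subr_eq0 => /eqP.
Qed.

Lemma trmx_horner_mx n (A : 'M[F]_n.+1) p :
  (horner_mx A p)^T = horner_mx A^T p.
Proof.
elim/poly_ind: p => [|p c IH]; first by rewrite !rmorph0 trmx0.
rewrite !rmorphD !rmorphM /= !horner_mx_C !horner_mx_X linearD /= trmx_mul IH.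
by rewrite tr_scalar_mx; congr (_ + _); apply: comm_mx_horner.
Qed.

(* [M] is a polynomial in [invmx A] whose square is [invmx A]: it inherits from
   [A] both the symmetry and the commutation with [D]. *)
Lemma symmetric_congr1 n (A : 'M[F]_n) : A^T = A -> A \in unitmx ->
  exists M, M^T *m A *m M = 1%:M /\
    forall D, comm_mx D A -> comm_mx D M.
Proof.
case: n A => [|n] A symA uA.
  by exists 0; split=> [|D _]; apply/matrixP => -[].
have [p pE] := mx_sqrt (etrans (unitmx_inv A) uA).
set M := horner_mx _ p in pE; exists M.
have DM D : comm_mx D A -> comm_mx D M.
  move=> DA; apply: comm_mx_horner; rewrite /comm_mx.
  by rewrite -[LHS](mulKmx uA) (mulmxA A) -DA mulmxK.
split=> //.
have -> : M^T = M by rewrite trmx_horner_mx trmx_inv symA.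
by rewrite -(DM A) // -mulmxA [M *m M]pE mulmxV.
Qed.
End ClosedField.

(** * Laurent polynomials in one variable and simultaneous diagonalization *)

Section Laurent.
Variable F : fieldType.

(** Laurent polynomials seen as functions on the nonzero scalars; the value at 0 is free. *)
Definition laurent (h : F -> F) : Prop :=
  exists k (p : {poly F}), forall z, z != 0 -> z ^+ k * h z = p.[z].

Lemma eq_laurent h h' :
  (forall z, z != 0 -> h z = h' z) -> laurent h -> laurent h'.
Proof. by move=> hh' [k [p hp]]; exists k, p => z z0; rewrite -hh' // hp. Qed.

Lemma laurent_cst c : laurent (fun=> c).
Proof. by exists 0%N, c%:P => z _; rewrite hornerC mul1r. Qed.

Lemma laurent_id : laurent id.
Proof. by exists 0%N, 'X => z _; rewrite hornerX mul1r. Qed.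

Lemma laurentD h h' : laurent h -> laurent h' -> laurent (fun z => h z + h' z).
Proof.
move=> [k [p hp]] [k' [p' hp']].
exists (k + k')%N, ('X^k' * p + 'X^k * p') => z z0.
by rewrite !(hornerD, hornerM, hornerXn) -hp // -hp' // exprD; ring.
Qed.

Lemma laurentM h h' : laurent h -> laurent h' -> laurent (fun z => h z * h' z).
Proof.
move=> [k [p hp]] [k' [p' hp']]; exists (k + k')%N, (p * p') => z z0.
by rewrite !(hornerD, hornerM, hornerXn) -hp // -hp' // exprD; ring.
Qed.

Lemma laurent_sum (I : Type) (r : seq I) (h : I -> F -> F) :
  (forall i, laurent (h i)) -> laurent (fun z => \sum_(i <- r) h i z).
Proof.
move=> hl; elim: r => [|i r IH].
  by apply: eq_laurent (laurent_cst 0) => z _; rewrite big_nil.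
by apply: eq_laurent (laurentD (hl i) IH) => z _; rewrite big_cons.
Qed.

Lemma laurent_prod (I : Type) (r : seq I) (h : I -> F -> F) :
  (forall i, laurent (h i)) -> laurent (fun z => \prod_(i <- r) h i z).
Proof.
move=> hl; elim: r => [|i r IH].
  by apply: eq_laurent (laurent_cst 1) => z _; rewrite big_nil.
by apply: eq_laurent (laurentM (hl i) IH) => z _; rewrite big_cons.
Qed.

Lemma laurent_det n (h : F -> 'M[F]_n) :
  (forall i j, laurent (fun z => h z i j)) -> laurent (fun z => \det (h z)).
Proof.
move=> hl; apply: laurent_sum => s.
by apply: laurentM; [exact: laurent_cst|exact: laurent_prod].
Qed.

Lemma laurentV h : laurent h -> laurent (fun z => h z^-1).
Proof.
move=> [k [p hp]].
(* Here [h z^-1 = z ^+ k * p.[z^-1]], and the factor [z ^+ size p] clears the negative exponents. *)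
exists (size p), (\sum_(i < size p) p`_i *: 'X^(size p - i + k)) => z z0.
have zk : z ^+ k != 0 by rewrite expf_neq0.
have -> : h z^-1 = z ^+ k * p.[z^-1] by rewrite -hp ?invr_eq0 // exprVn mulVKf.
rewrite horner_coef horner_sum !mulr_sumr; apply: eq_bigr => i _.
rewrite hornerZ hornerXn exprD exprB ?unitfE // 1?ltnW // exprVn; ring.
Qed.

(** All exponents lie between [-m] and [m], so that the numerator has degree at most [2m]. *)
Definition laurent_le m (h : F -> F) : Prop :=
  exists2 p : {poly F}, (size p <= m.*2.+1)%N &
    forall z, z != 0 -> z ^+ m * h z = p.[z].

Lemma laurent_leW m m' h : (m <= m')%N -> laurent_le m h -> laurent_le m' h.
Proof.
move=> le_mm' [p sp hp]; exists ('X^(m' - m) * p).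
  rewrite (leq_trans (size_polyMleq _ _)) // size_polyXn; lia.
by move=> z z0; rewrite hornerM hornerXn -hp // mulrA -exprD subnK.
Qed.

Lemma laurentP h : laurent h <-> exists m, laurent_le m h.
Proof.
split=> [[k [p hp]]|[m [p _ hp]]]; last by exists m, p.
exists (k + size p)%N, ('X^(size p) * p).
  rewrite (leq_trans (size_polyMleq _ _)) // size_polyXn; lia.
by move=> z z0; rewrite hornerM hornerXn -hp // addnC exprD mulrA.
Qed.

Lemma laurent_le_sum m (I : Type) (r : seq I) (a : I -> F) (h : I -> F -> F) :
  (forall i, laurent_le m (h i)) ->
  laurent_le m (fun z => \sum_(i <- r) a i * h i z).
Proof.
move=> hm; elim: r => [|i r [p sp hp]].
  by exists 0 => [|z _]; rewrite ?size_poly0 // big_nil hornerC mulr0.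
have [q sq hq] := hm i; exists (a i *: q + p) => [|z z0].
  rewrite (leq_trans (size_polyD _ _)) // geq_max.
  by rewrite (leq_trans (size_scale_leq _ _)).
by rewrite big_cons hornerD hornerZ -hp // -hq //; ring.
Qed.

Lemma laurent_le_uniform (I : finType) (h : I -> F -> F) :
  (forall i, laurent (h i)) -> exists m, forall i, laurent_le m (h i).
Proof.
move=> hl; have /fin_all_exists[m hm] := fun i => (laurentP (h i)).1 (hl i).
by exists (\max_i m i)%N => i; apply: laurent_leW (hm i); apply: leq_bigmax.
Qed.

Lemma prim_root_neq0 k (w : F) : k.-primitive_root w -> w != 0.
Proof.
move=> prim_w; apply: contra_eqN (prim_expr_order prim_w) => /eqP ->.
by rewrite expr0n eqn0Ngt (prim_order_gt0 prim_w) eq_sym oner_eq0.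
Qed.

(** The numerator has degree at most [2m] but vanishes at the [2m + 2] distinct powers of [w]. *)
Lemma laurent_le_eq0 m w h : (m.*2.+2).-primitive_root w ->
  laurent_le m h -> (forall k, h (w ^+ k) = 0) -> forall z, z != 0 -> h z = 0.
Proof.
move=> prim_w [p sp hp] hw z z0.
suff p0 : p = 0.
  by apply: (mulfI (expf_neq0 m z0)); rewrite hp // p0 hornerC mulr0.
apply/eqP; apply: contraTT isT => p0.
pose rs := [seq w ^+ i | i <- iota 0 m.*2.+2].
have := @max_poly_roots _ p rs p0; rewrite size_map size_iota.
rewrite ltnNge (leq_trans sp) //; apply.
  apply/allP => _ /mapP[k _ ->]; rewrite /root -hp ?hw ?mulr0 //.
  by rewrite expf_neq0 // (prim_root_neq0 prim_w).
rewrite map_inj_in_uniq ?iota_uniq // => i j.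
rewrite !mem_iota !add0n /= => lti ltj /eqP.
by rewrite (eq_prim_root_expr prim_w) !modn_small // => /eqP.
Qed.

End Laurent.

Lemma mulmx_is_diag (F : fieldType) n (A B : 'M[F]_n) :
  is_diag_mx A -> is_diag_mx B -> is_diag_mx (A *m B).
Proof.
by move=> /diag_mxP[d ->] /diag_mxP[e ->]; rewrite mulmx_diag diag_mx_is_diag.
Qed.

(* Each [u i] is determined by its values at the powers of a root of unity of
   large order, and these values are the powers of a single matrix of finite
   order. *)
Lemma codiagonalizable_laurent (F : numClosedFieldType) r n
    (u : 'I_r -> F -> 'M[F]_n) :
    (forall i, u i 1 = 1%:M) ->
    (forall i z w, z != 0 -> w != 0 -> u i (z * w) = u i z *m u i w) ->
    (forall i j z w, z != 0 -> w != 0 -> comm_mx (u i z) (u j w)) ->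
    (forall i a b, laurent (fun z => u i z a b)) ->
  exists2 Q, Q \in unitmx &
    forall i z, z != 0 -> is_diag_mx (invmx Q *m u i z *m Q).
Proof.
move=> u1 uM uC ul.
have [m um] :=
  laurent_le_uniform (fun t : 'I_r * 'I_n * 'I_n => ul t.1.1 t.1.2 t.2).
have [w prim_w] := prim_root_exists F (ltn0Sn m.*2.+1).
have w0 k : w ^+ k != 0 by rewrite expf_neq0 // (prim_root_neq0 prim_w).
have uX i k : u i (w ^+ k) = iter k (mulmx (u i w)) 1%:M.
  by elim: k => [|k IH]; rewrite ?u1 // exprS uM ?IH //; have := w0 1%N.
have [] := (codiagonalizableP [seq u i w | i <- enum 'I_r]).1.
  split=> [_ _ /mapP[i _ ->] /mapP[j _ ->]|_ /mapP[i _ ->]].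
    by apply: uC; apply: (w0 1%N).
  apply: (@diagonalizable_finite_order _ _ _ m.*2.+2) => //.
  by rewrite -uX prim_expr_order.
move=> P uP /allP Pu.
exists (invmx P) => [|i z z0]; first by rewrite unitmx_inv.
rewrite invmxK; apply/is_diag_mxP => a b ab.
have diagX k : is_diag_mx (P *m u i (w ^+ k) *m invmx P).
  have /Pu : u i w \in [seq u i w | i <- enum 'I_r].
    by apply: map_f; rewrite mem_enum.
  rewrite uX => /(diagonalizable_forP _ uP)/is_diag_mxP; set v := u i w => Pv.
  elim: k => [|k IH] /=; first by rewrite mulmx1 mulmxV // scalar_mx_is_diag.
  set y := iter _ _ _ in IH *.
  have -> : P *m (v *m y) *m invmx P =
      (P *m v *m invmx P) *m (P *m y *m invmx P).
    by rewrite !mulmxA mulmxKV.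
  exact: mulmx_is_diag.
(* This off-diagonal entry is a fixed linear combination of the entries of [u i z], so it obeys the
   same bound [m] and is determined by its values at the powers of [w]. *)
pose h z := (P *m u i z *m invmx P) a b.
apply: (@laurent_le_eq0 _ m w h prim_w) => //.
  have : laurent_le m (fun z => \sum_(t : 'I_n * 'I_n)
      (P a t.1 * invmx P t.2 b) * u i z t.1 t.2).
    by apply: laurent_le_sum => t; apply: (um (i, t.1, t.2)).
  case=> p sp hp; exists p => // y y0; rewrite -hp //; congr (_ * _).
  rewrite /h mxE -(pair_bigA _ (fun c d => P a c * invmx P d b * u i y c d)) /=.
  rewrite exchange_big; apply: eq_bigr => d _.
  by rewrite mxE mulr_suml; apply: eq_bigr => c _; ring.
by move=> k; move/is_diag_mxP: (diagX k) => /(_ a b ab).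
Qed.

(** * Homomorphisms of linear groups *)

Section Continuity.
Variables (R : realType) (X : topologicalType).
Local Notation C := R[i].

Lemma continuous_mx m n (f : X -> 'M[C]_(m, n)) :
  (forall i j, continuous (fun x => f x i j)) -> continuous f.
Proof.
move=> fc x A [P nP PA].
have: \forall y \near x, forall i j, P i j (f y i j).
  apply: filter_forall => i; apply: filter_forall => j.
  exact: (fc i j x _ (nP i j)).
by apply: filterS => y yP; apply: PA => i j; apply: yP.
Qed.

Lemma continuous_entry m n (f : X -> 'M[C]_(m, n)) i j :
  continuous f -> continuous (fun x => f x i j).
Proof.
move=> fc x; apply: (@continuous_comp _ _ _ f (fun M : 'M[C]_(m, n) => M i j)).
  exact: fc.
exact: (@coord_continuous C).
Qed.

Lemma continuous_mulmx m n p q (U : 'M[C]_(m, n)) (f : X -> 'M[C]_(n, p))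
    (V : 'M[C]_(p, q)) :
  continuous f -> continuous (fun x => U *m f x *m V).
Proof.
move=> fc; apply: continuous_mx => i j.
have -> : (fun x => (U *m f x *m V) i j) =
    (fun x => \sum_b (\sum_a U i a * f x a b) * V b j).
  by apply/funext => x; rewrite mxE; apply: eq_bigr => b _; rewrite mxE.
apply: continuous_big => [|b _ x].
  exact: (@add_continuous C^o).
apply: (@continuousM C); last exact: cst_continuous.
apply: continuous_big => [|a _ {}x]; first exact: (@add_continuous C^o).
apply: (@continuousM C); first exact: cst_continuous.
exact: continuous_entry.
Qed.

Lemma continuous_diag_mx n (f : X -> 'rV[C]_n) :
  (forall i, continuous (fun x => f x 0 i)) ->
  continuous (fun x => diag_mx (f x)).
Proof.
move=> fc; apply: continuous_mx => i j.
have [<-|ij] := eqVneq i j.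
  have -> : (fun x => diag_mx (f x) i i) = (fun x => f x 0 i).
    by apply/funext => x; rewrite mxE eqxx mulr1n.
  exact: fc.
have -> : (fun x => diag_mx (f x) i j) = cst 0.
  by apply/funext => x; rewrite mxE (negbTE ij) mulr0n.
exact: cst_continuous.
Qed.

End Continuity.

(** * Induced maps between classifying spaces, and conjugation *)

Section Hmap.
Variables (R : realType) (A : nzRingType).

Lemma hmapD N M (G : lingroup R N) (H : lingroup R M) (f : lhom G H)
  (x y : Hcoh H A) : hmap f (x + y) = hmap f x + hmap f y.
Proof. exact: pullbackD. Qed.

Lemma hmap1 N M (G : lingroup R N) (H : lingroup R M) (f : lhom G H) :
  hmap f (1 : Hcoh H A) = 1.
Proof. exact: pullback1. Qed.

Lemma hmap_sum N M (G : lingroup R N) (H : lingroup R M) (f : lhom G H)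
    (n : nat) (x : nat -> Hcoh H A) :
  hmap f (\sum_(k < n.+1) x k) = \sum_(k < n.+1) hmap f (x k).
Proof.
elim: n => [|n IH]; first by rewrite !big_ord1.
by rewrite big_ord_recr hmapD IH [RHS]big_ord_recr.
Qed.

Lemma hmap_comp N M L (G : lingroup R N) (H : lingroup R M) (K : lingroup R L)
    (f : lhom G H) (g : lhom H K) (h : lhom G K) (x : Hcoh K A) :
  (forall y, lset G y -> h y = g (f y)) -> hmap f (hmap g x) = hmap h x.
Proof.
move=> hE; apply: pullback_comp => n s; apply: bsimplexP => i j u /=.
exact/hE/bsimplex_mem.
Qed.

Section Conjugation.
Variables (N M : nat) (G : lingroup R N) (H : lingroup R M) (f : lhom G H).
Variable S : 'M[R[i]]_M.
Hypothesis HS : lset H S.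

Section Simplex.
Variables (n : nat) (e : 'I_n.+1 -> bool) (s : classifying G n).
Let S_ (b : bool) := if b then S else 1%:M.
Let y i j t := invmx (S_ (e i)) *m f (bfun s i j t) *m S_ (e j).

Let S_mem b : lset H (S_ b).
Proof. by case: b => //; apply: lingroup1. Qed.

Let y_mem i j t : lset H (y i j t).
Proof.
apply: lingroupM (S_mem _); apply: lingroupM; first exact/lingroupV/S_mem.
exact/lhom_mem/bsimplex_mem.
Qed.

Let yM i j k t : y i j t *m y j k t = y i k t.
Proof.
rewrite /y !mulmxA mulmxK; last exact: lingroup_unit (S_mem _).
by rewrite -(bsimplexM s i j k) lhomM ?mulmxA //; apply: bsimplex_mem.
Qed.

Let y_continuous i j : continuous (y i j).
Proof.
apply: continuous_mulmx; exact: (@bsimplex_continuous _ _ _ _ (bmap_fun f s)).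
Qed.

(** A gauge transformation of the image of [s]: [S] at the vertices marked true, the identity at the
    others. The factors at inner vertices cancel in products. *)
Definition conj_homotopy : classifying H n := BSimplex y_mem yM y_continuous.
End Simplex.

(* Conjugation by an element of the target is a natural isomorphism of functors
   into the one-object groupoid, hence a homotopy. *)
Lemma hmap_conj (g : lhom G H) (x : Hcoh H A) :
  (forall y, lset G y -> g y = invmx S *m f y *m S) -> hmap f x = hmap g x.
Proof.
move=> gE; apply: (@homotopic_pullback _ _ _ conj_homotopy) => n //.
- by move=> m k e s; apply: bsimplexP.
- move=> s; apply: bsimplexP => i j u.
  by rewrite /= invmx1 mul1mx mulmx1.
- move=> s; apply: bsimplexP => i j u /=.
  exact/gE/bsimplex_mem.
Qed.

End Conjugation.
End Hmap.

Section MatrixCoefficient.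
Variables (R : realType) (N M L : nat) (G : lingroup R N) (H : lingroup R M).
Variables (K : lingroup R L) (f : lhom G H).
Variables (U : 'M[R[i]]_(L, M)) (V : 'M[R[i]]_(M, L)).
Hypothesis UVK : forall x, lset G x -> lset K (U *m f x *m V).
Hypothesis UVM : forall x y, lset G x -> lset G y ->
  U *m f (x *m y) *m V = (U *m f x *m V) *m (U *m f y *m V).

Let UV_continuous : {within G, continuous (fun x => U *m f x *m V)}%classic.
Proof. exact/continuous_mulmx/lhom_continuous. Qed.

(** Rectangular [U] and [V] are allowed: a row of [invmx Q] and a column of [Q] will yield a
    character. *)
Definition lhom_mulmx : lhom G K := LHom UVK UVM UV_continuous.

End MatrixCoefficient.

(** * Total classes of sums of characters, for GL_n and O_n at once *)

Section Diagonal.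
Variables (R : realType) (F : forall n, lingroup R n).
Hypothesis F_diag : forall n (d : 'rV[R[i]]_n),
  (forall i, lset (F 1) (d 0 i)%:M) -> lset (F n) (diag_mx d).

Section Def.
Variables (N n : nat) (G : lingroup R N) (chi : 'I_n -> lhom G (F 1)).
Let D x := diag_mx (\row_i chi i x 0 0).

Let D_mem x : lset G x -> lset (F n) (D x).
Proof.
move=> Gx; apply: F_diag => i; rewrite mxE -mx11_scalar; exact: lhom_mem.
Qed.

Let DM x y : lset G x -> lset G y -> D (x *m y) = D x *m D y.
Proof.
move=> Gx Gy; rewrite /D mulmx_diag; congr diag_mx; apply/rowP => i.
by rewrite !mxE lhomM // mxE big_ord1.
Qed.

Let D_continuous : {within G, continuous D}%classic.
Proof.
apply: continuous_diag_mx => i.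
have -> : (fun x => (\row_j chi j x 0 0) 0 i) = (fun x => chi i x 0 0).
  by apply/funext => x; rewrite mxE.
exact/continuous_entry/lhom_continuous.
Qed.

Definition lhom_diag : lhom G (F n) := LHom D_mem DM D_continuous.
End Def.

Variables (A : nzRingType) (c : forall n, nat -> Hcoh (F n) A) (d : nat).
Hypothesis hc : universal_classes c d.

(** By induction on [n], the Whitney formula splits off the first character on the left; in rank 0
    only the class of index 0, which is 1, remains. *)
Lemma total_class_diag N (G : lingroup R N) n (chi : 'I_n -> lhom G (F 1))
    (h : lhom G (F n)) :
  (forall x, lset G x -> h x = diag_mx (\row_i chi i x 0 0)) ->
  total_class c h = \prod_(i < n) (1 + hmap (chi i) (c 1%N 1%N)).
Proof.
elim: n chi h => [|n IH] chi h hE.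
  by rewrite big_ord0 /total_class big_ord1 (universal0 hc) hmap1.
rewrite big_ord_recl.
rewrite (universal_whitney hc (f := chi ord0)
  (g := lhom_diag (fun i => chi (lift ord0 i))) (h := h : lhom G (F (1 + n)))).
  rewrite (IH (fun i => chi (lift ord0 i))) //; congr (_ * _).
  by rewrite /total_class big_ord_recr big_ord1 (universal0 hc) hmap1.
move=> x Gx; rewrite hE //=.
have -> : \row_i chi i x 0 0 =
    row_mx (chi ord0 x) (\row_i chi (lift ord0 i) x 0 0).
  apply/rowP => i; rewrite !mxE; case: splitP => j ij.
    by rewrite ord1 (_ : i = ord0) //; apply: val_inj; rewrite /= ij ord1.
  by rewrite mxE; congr (chi _ x 0 0); apply: val_inj.
apply: etrans (diag_mx_row _ _) _; congr block_mx.
by apply/matrixP => i j; rewrite !ord1 mxE eqxx.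
Qed.

Lemma total_class_conj N (G : lingroup R N) n (f g : lhom G (F n)) S :
  lset (F n) S -> (forall x, lset G x -> g x = invmx S *m f x *m S) ->
  total_class c f = total_class c g.
Proof.
by move=> FS gE; apply: eq_bigr => k _; apply: (hmap_conj FS).
Qed.

End Diagonal.

(** * Diagonalization of representations of a torus *)

Section Torus.
Variable R : realType.
Local Notation C := R[i].

Lemma regular_sum n (I : Type) (r : seq I) (p : I -> 'M[C]_n -> C) :
  (forall i, regular (p i)) -> regular (fun x => \sum_(i <- r) p i x).
Proof.
move=> pr; elim: r => [|i r IH].
  have -> : (fun x => \sum_(i <- [::]) p i x) = (fun=> 0).
    by apply/funext => x; rewrite big_nil.
  exact: regular_cst.
have -> : (fun x => \sum_(j <- i :: r) p j x) =
    (fun x => p i x + \sum_(j <- r) p j x).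
  by apply/funext => x; rewrite big_cons.
exact: regularD.
Qed.

(** The inverse determinant is one of the generators of the regular functions, but Laurent
    polynomials are not closed under inversion; hence the separate hypothesis on it. *)
Lemma laurent_regular n (y : C -> 'M[C]_n) (p : 'M[C]_n -> C) :
  (forall i j, laurent (fun z => y z i j)) ->
  laurent (fun z => (\det (y z))^-1) ->
  regular p -> laurent (fun z => p (y z)).
Proof.
move=> yl dl; elim=> [i j|a||q q' _ ql _ ql'|q q' _ ql _ ql'] //.
- exact: laurent_cst.
- exact: laurentD.
- exact: laurentM.
Qed.

Lemma laurent_algebraic N M (G : lingroup R N) (H : lingroup R M)
    (f : lhom G H) (y : C -> 'M[C]_N) :
  algebraic f -> (forall z, z != 0 -> lset G (y z)) ->
  (forall i j, laurent (fun z => y z i j)) ->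
  laurent (fun z => (\det (y z))^-1) ->
  forall i j, laurent (fun z => f (y z) i j).
Proof.
move=> af Gy yl dl i j; have [p pr fp] := af i j.
apply: eq_laurent (laurent_regular yl dl pr) => z z0.
by rewrite fp //; apply: Gy.
Qed.

(** The [i]-th coordinate cocharacter of the standard torus; together these generate it. *)
Definition coord_mx r (i : 'I_r) (z : C) : 'M[C]_r :=
  diag_mx (\row_j if j == i then z else 1).

Lemma coord_mxM r (i : 'I_r) z w :
  coord_mx i (z * w) = coord_mx i z *m coord_mx i w.
Proof.
rewrite mulmx_diag; congr diag_mx; apply/rowP => j; rewrite !mxE.
by case: eqP => _ //; rewrite mulr1.
Qed.

Lemma coord_mx1 r (i : 'I_r) : coord_mx i 1 = 1%:M.
Proof.
rewrite -diag_const_mx; congr diag_mx; apply/rowP => j; rewrite !mxE.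
by case: eqP.
Qed.

Lemma coord_mx_Gm r (i : 'I_r) z : z != 0 -> lset (Gm R r) (coord_mx i z).
Proof.
move=> z0; exists (\row_j if j == i then z else 1) => // j; rewrite mxE.
by case: ifP => _ //; rewrite oner_eq0.
Qed.

Lemma det_coord_mx r (i : 'I_r) z : \det (coord_mx i z) = z.
Proof.
rewrite det_diag (bigD1 i) //= mxE eqxx big1 ?mulr1 // => j /negbTE ji.
by rewrite mxE ji.
Qed.

Lemma laurent_coord_mx r (i a b : 'I_r) : laurent (fun z => coord_mx i z a b).
Proof.
have [<-|ab] := eqVneq a b; last first.
  by apply: eq_laurent (@laurent_cst C 0) => z _; rewrite mxE (negbTE ab).
have [->|ai] := eqVneq a i.
  by apply: eq_laurent (@laurent_id C) => z _; rewrite !mxE !eqxx.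
apply: eq_laurent (@laurent_cst C 1) => z _.
by rewrite !mxE eqxx (negbTE ai).
Qed.

(** Transported to [T] by [g] and composed with [pi], the coordinate cocharacters commute and have
    Laurent entries, so one [Q] diagonalizes them all. Every element of [T] is a product of their
    values. *)
Lemma torus_diagonalizable N (T : torus R N) n (pi : lhom T (GLn R n)) :
  algebraic pi -> exists2 Q, Q \in unitmx &
    forall x, lset T x -> is_diag_mx (invmx Q *m pi x *m Q).
Proof.
move=> api; have [r [f [g [_ ag gf _]]]] := torus_iso T.
pose y i z := g (coord_mx i z); pose u i z := pi (y i z).
have Ty i z : z != 0 -> lset T (y i z) by move=> /(coord_mx_Gm i)/(lhom_mem g).
have yM i z w : z != 0 -> w != 0 -> y i (z * w) = y i z *m y i w.
  by move=> z0 w0; rewrite /y coord_mxM lhomM //; apply: coord_mx_Gm.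
have y1 i : y i 1 = 1%:M by rewrite /y coord_mx1 lhom1.
have yl i a b : laurent (fun z => y i z a b).
  apply: (laurent_algebraic ag); first exact: coord_mx_Gm.
    exact: laurent_coord_mx.
  apply: eq_laurent (laurentV (@laurent_id C)) => z _.
  by rewrite det_coord_mx.
have [||||Q uQ Qu] := @codiagonalizable_laurent C r n u.
- by move=> i; rewrite /u y1 lhom1.
- by move=> i z w z0 w0; rewrite /u yM // lhomM //; apply: Ty.
- move=> i j z w z0 w0.
  have [Tiz Tjw] := (Ty i z z0, Ty j w w0).
  rewrite /comm_mx /u -(lhomM pi Tiz Tjw) (torus_comm Tiz Tjw).
  exact: lhomM.
- move=> i; apply: (laurent_algebraic api) => //; first exact: Ty.
  (* The inverse of [\det (y i z)] is [\det (y i z^-1)], again a Laurent polynomial. *)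
  apply: eq_laurent (laurentV (laurent_det (yl i))) => z z0.
  have : \det (y i z) * \det (y i z^-1) = 1.
    by rewrite -det_mulmx -yM ?invr_eq0 // mulfV // y1 det1.
  by move=> d1; apply/esym/(mulr1_eq d1).
exists Q => // x Tx; rewrite -(gf _ Tx); have [d d0 <-] := lhom_mem f Tx.
(* The partial product of the first [k] coordinate factors of [diag_mx d]. *)
pose dk k := diag_mx (\row_j if (j < k)%N then d 0 j else 1).
have Gdk k : lset (Gm R r) (dk k).
  by eexists; last by []; move=> j; rewrite mxE; case: ifP; rewrite ?oner_eq0.
have dkS (i : 'I_r) : dk i.+1 = dk i *m coord_mx i (d 0 i).
  rewrite mulmx_diag; congr diag_mx; apply/rowP => j; rewrite !mxE ltnS.
  case: (ltngtP j i) => [ji|ij|/val_inj->]; rewrite ?mul1r ?eqxx //.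
  - by rewrite -val_eqE ltn_eqF // mulr1.
  - by rewrite -val_eqE gtn_eqF.
have -> : diag_mx d = dk r.
  by congr diag_mx; apply/rowP => j; rewrite mxE ltn_ord.
suff dQ k : (k <= r)%N -> is_diag_mx (invmx Q *m pi (g (dk k)) *m Q).
  exact: dQ.
elim: k => [_|k IH kr].
  have -> : dk 0%N = 1%:M.
    by rewrite -diag_const_mx; congr diag_mx; apply/rowP => j; rewrite !mxE.
  by rewrite !lhom1 mulmx1 mulVmx // scalar_mx_is_diag.
have Gk := coord_mx_Gm (Ordinal kr) (d0 (Ordinal kr)).
rewrite (dkS (Ordinal kr)) lhomM // lhomM; try exact: lhom_mem.
set a := pi _; set b := pi _.
have -> : invmx Q *m (a *m b) *m Q = (invmx Q *m a *m Q) *m (invmx Q *m b *m Q).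
  by rewrite !mulmxA mulmxK.
by apply: mulmx_is_diag; [exact/IH/ltnW|exact: Qu].
Qed.

End Torus.

(** * Restriction to T[2] and the characters of a diagonalized representation *)

Section Characters.
Variable R : realType.
Local Notation C := R[i].

Lemma GLn_diag n (d : 'rV[C]_n) :
  (forall i, lset (GLn R 1) (d 0 i)%:M) -> lset (GLn R n) (diag_mx d).
Proof.
move=> ud; rewrite /= /mkset unitmxE det_diag unitfE; apply/prodf_neq0 => i _.
by have := ud i; rewrite /= /mkset unitmxE det_scalar1 unitfE.
Qed.

Lemma On_diag n (d : 'rV[C]_n) :
  (forall i, lset (On R 1) (d 0 i)%:M) -> lset (On R n) (diag_mx d).
Proof.
move=> dd; rewrite /= /mkset tr_diag_mx mulmx_diag -diag_const_mx.
congr diag_mx; apply/rowP => i; rewrite !mxE.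
have := dd i; rewrite /= /mkset tr_scalar_mx -scalar_mxM.
by move=> /matrixP/(_ 0 0); rewrite !mxE !eqxx.
Qed.

Section Restriction.
Variables (N : nat) (T : torus R N) (n : nat) (H : lingroup R n) (f : lhom T H).

Let restrict_mem x : lset (two_torsion T) x -> lset H (f x).
Proof. by case=> Tx _; apply: lhom_mem. Qed.

Let restrictM x y : lset (two_torsion T) x -> lset (two_torsion T) y ->
  f (x *m y) = f x *m f y.
Proof. by move=> [Tx _] [Ty _]; apply: lhomM. Qed.

Let restrict_continuous : {within two_torsion T, continuous f}%classic.
Proof.
by apply: continuous_subspaceW (@lhom_continuous _ _ _ _ _ f) => x [].
Qed.

Definition lhom_restrict : lhom (two_torsion T) H :=
  LHom restrict_mem restrictM restrict_continuous.
End Restriction.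

Section DiagonalEntries.
Variables (N n : nat) (G : lingroup R N) (pi : lhom G (GLn R n)) (Q : 'M[C]_n).
Hypothesis uQ : Q \in unitmx.
Hypothesis Q_diag : forall x, lset G x -> is_diag_mx (invmx Q *m pi x *m Q).

Let row_col i x : row i (invmx Q) *m pi x *m col i Q =
  ((invmx Q *m pi x *m Q) i i)%:M.
Proof.
rewrite -row_mul [LHS]mx11_scalar; congr _%:M; rewrite !mxE.
by apply: eq_bigr => j _; rewrite !mxE.
Qed.

Let character_mem i x : lset G x ->
  lset (GLn R 1) (row i (invmx Q) *m pi x *m col i Q).
Proof.
move=> Gx; rewrite row_col /= /mkset unitmxE det_scalar1.
have : invmx Q *m pi x *m Q \in unitmx.
  by rewrite !unitmx_mul unitmx_inv uQ (lhom_mem pi Gx).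
have /diag_mxP[d ->] := Q_diag Gx.
by rewrite unitmxE det_diag mxE eqxx !unitfE => /prodf_neq0; apply.
Qed.

Let characterM i x y : lset G x -> lset G y ->
  row i (invmx Q) *m pi (x *m y) *m col i Q =
  (row i (invmx Q) *m pi x *m col i Q) *m (row i (invmx Q) *m pi y *m col i Q).
Proof.
move=> Gx Gy; rewrite !row_col -scalar_mxM lhomM //; congr _%:M.
have -> : invmx Q *m (pi x *m pi y) *m Q =
    (invmx Q *m pi x *m Q) *m (invmx Q *m pi y *m Q).
  by rewrite !mulmxA mulmxK.
have /diag_mxP[d ->] := Q_diag Gx; have /diag_mxP[e ->] := Q_diag Gy.
by rewrite mulmx_diag !mxE eqxx.
Qed.

Definition character i : lhom G (GLn R 1) :=
  lhom_mulmx (@character_mem i) (@characterM i).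

Lemma characterE x : lset G x ->
  invmx Q *m pi x *m Q = diag_mx (\row_i character i x 0 0).
Proof.
move=> Gx; have /diag_mxP[d dE] := Q_diag Gx; rewrite dE; congr diag_mx.
by apply/rowP => i; rewrite mxE [character i x]row_col dE !mxE eqxx.
Qed.

(** Needed because [phi] is prescribed on algebraic characters only. A character is a fixed linear
    combination of the entries of [pi x]. *)
Lemma algebraic_character i : algebraic pi -> algebraic (character i).
Proof.
move=> api a b; have /boolp.choice[p pP] : forall t : 'I_n * 'I_n, exists p,
    regular p /\ forall x, lset G x -> pi x t.1 t.2 = p x.
  by move=> t; have [p] := api t.1 t.2; exists p.
exists (fun x => \sum_t (invmx Q i t.1 * Q t.2 i) * p t x).
  apply: regular_sum => t.
  apply: (@regularM R N (fun=> invmx Q i t.1 * Q t.2 i) (p t)).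
    exact: regular_cst.
  exact: (pP t).1.
move=> x Gx; rewrite [character i x]row_col !ord1 mxE eqxx mulr1n mxE.
rewrite [RHS](eq_bigr (fun t => invmx Q i t.1 * Q t.2 i * pi x t.1 t.2));
  last by move=> t _; rewrite (pP t).2.
rewrite -(pair_bigA _ (fun c d => invmx Q i c * Q d i * pi x c d)) /=.
rewrite exchange_big; apply: eq_bigr => d _.
rewrite mxE mulr_suml; apply: eq_bigr => c _.
by rewrite mulrAC.
Qed.

End DiagonalEntries.
End Characters.

(** * Comparison of the two total classes *)

Theorem proposition9 (R : realType)
    (c : forall n, nat -> Hcoh (GLn R n) int) (hc : chern_classes c)
    (w : forall n, nat -> Hcoh (On R n) 'F_2) (hw : stiefel_whitney_classes w)
    (N : nat) (T : torus R N)
    (phi : {rmorphism Hcoh T int -> Hcoh (two_torsion T) 'F_2})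
    (hphi : forall chi : lhom T (GLn R 1), algebraic chi ->
      phi (hmap chi (c 1%N 1%N)) = hmap (char2 chi) (w 1%N 1%N))
    (n : nat) (pi : lhom T (GLn R n)) (hpi : algebraic pi)
    (B : 'M[R[i]]_n) (hB : invariant_form pi B)
    (P : 'M[R[i]]_n) (rho : lhom T (On R n))
    (hrho : orthonormal_matrices pi B P rho) :
  hmap (incl2 T) (total_class w rho) = phi (total_class c pi).
Proof.
have [Q uQ Q_diag] := torus_diagonalizable hpi.
pose chi := character uQ Q_diag.
pose D x := diag_mx (\row_i chi i x 0 0).
have DE x : lset T x -> D x = invmx Q *m pi x *m Q.
  by move=> Tx; apply/esym/characterE.
have [symB uB piB] := hB; have [PBP piP] := hrho.
have uP : P \in unitmx by have [] := mulmx1_unit PBP.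
pose G := Q^T *m B *m Q.
have symG : G^T = G by rewrite /G !trmx_mul trmxK symB mulmxA.
have uG : G \in unitmx by rewrite !unitmx_mul unitmx_tr uQ uB.
have [M [MGM commM]] := symmetric_congr1 symG uG.
have uM : M \in unitmx by have [] := mulmx1_unit MGM.
have DM x : lset (two_torsion T) x -> D x *m M = M *m D x.
  move=> [Tx xx]; apply: commM; rewrite /comm_mx.
  (* On T[2] the matrix [D x] is a symmetric involution, so invariance of [G] under it means
     commutation with [G]. *)
  have DD : D x *m D x = 1%:M.
    rewrite DE // !mulmxA mulmxK // -(mulmxA (invmx Q)) -lhomM // xx lhom1.
    by rewrite mulmx1 mulVmx.
  have DGD : (D x)^T *m G *m D x = G.
    rewrite DE // /G !trmx_mul !mulmxA trmx_inv mulmxKV ?unitmx_tr //.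
    by rewrite (mulmxK uQ) -(mulmxA Q^T _^T) -(mulmxA Q^T (_ *m B)) piB.
  by rewrite -[in RHS]DGD -(mulmxA _ (D x) (D x)) DD mulmx1 tr_diag_mx.
(* The transition matrix between the B-orthonormal bases [P] and [Q *m M], hence orthogonal. *)
pose S := invmx P *m Q *m M.
have OS : lset (On R n) S.
  rewrite /= /mkset; apply: mulmx1C.
  have BE : (invmx P)^T *m invmx P = B.
    rewrite -[_^T]mulmx1 -PBP trmx_inv !mulmxA mulVmx ?unitmx_tr //.
    by rewrite mul1mx mulmxK.
  rewrite /S !trmx_mul !mulmxA -(mulmxA _ _ (invmx P)) BE.
  by rewrite -(mulmxA M^T) -(mulmxA M^T).
(* Both sides express [pi x], in the bases [Q *m M] and [P]; for the first, [D x] must commute with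
   [M], hence the restriction to T[2]. *)
have rhoS x : lset (two_torsion T) x -> D x = invmx S *m rho x *m S.
  move=> T2x; have [Tx _] := T2x; have uS := lingroup_unit OS.
  apply: (can_inj (mulKmx uS)); rewrite !mulmxA mulmxV // mul1mx.
  rewrite /S -!mulmxA -DM // DE // !mulmxA mulmxK //.
  by rewrite -[rho x](mulKmx uP) -piP // !mulmxA mulmxK.
have -> : total_class c pi = \prod_i (1 + hmap (chi i) (c 1%N 1%N)).
  have [uc _] := hc; rewrite -(total_class_diag (@GLn_diag R) uc
    (h := lhom_diag (@GLn_diag R) chi)) //.
  by apply: (total_class_conj _ (S := Q)) => // x Tx; apply: DE.
have -> : hmap (incl2 T) (total_class w rho) =
    \prod_i (1 + hmap (char2 (chi i)) (w 1%N 1%N)).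
  have [uw _] := hw; rewrite -(total_class_diag (@On_diag R) uw
    (h := lhom_diag (@On_diag R) (fun i => char2 (chi i)))) //.
  (* [rhoS] is available on T[2] only, so [rho] is restricted before being conjugated. *)
  rewrite -(total_class_conj _ OS (f := lhom_restrict rho)) => [|x T2x].
    apply: (etrans (hmap_sum _ _ (fun k => hmap rho (w n k)))).
    apply: eq_bigr => k _.
    exact: hmap_comp.
  exact: rhoS.
rewrite rmorph_prod; apply: eq_bigr => i _.
by rewrite rmorphD rmorph1 hphi //; apply: algebraic_character.
Qed.
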